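(* Work in $\mathrm{GB}$ and let $\mathcal S=\langle\mathbb P,\mathcal G,\mathcal F\rangle$ be a class symmetric system. If $\mathcal S$ admits a forcing relation $\Vdash_0$ for atomic formulas, then $\mathcal S$ admits a forcing relation for any finite list of first-order formulas with fixed class $\mathcal S$-name parameters.
   Context: Base theory. $\mathrm{GB}$ is two-sorted Gödel--Bernays set theory without choice (lowercase variables for sets, uppercase for classes): Extensionality, Regularity, Pairing, Union, Infinity, Powerset for sets; Extensionality for classes; every set is a class; Separation ($a\cap A$ is a set for every set $a$ and class $A$); Collection (for every set $a$ and class relation $R$ with $\forall x\in a\,\exists y\,\langle x,y\rangle\in R$ there is a set $b$ with $\forall x\in a\,\exists y\in b\,\langle x,y\rangle\in R$); and class existence axioms equivalent to comprehension for first-order formulas. First-order formulas have no class quantifiers but may contain class variables and atomic formulas $x\in X$ and $X=Y$. The result is a scheme, one statement for each (metatheoretic) finite list of formulas. Class symmetric system. A triple $\mathcal S=\langle\mathbb P,\mathcal G,\mathcal F\rangle$ where: $\mathbb P=\langle P,\le\rangle$ is a preorder with $P,\le$ classes and weakest element $\mathsf 1$; $\mathcal G$ is a group of automorphisms of $\mathbb P$ parametrized by sets, i.e. there is a class $C_{\mathcal G}\subseteq V\times P^2$ such that for each $a\in\operatorname{dom}C_{\mathcal G}$, $\pi_a=\{\langle p,q\rangle\mid\langle a,p,q\rangle\in C_{\mathcal G}\}$ is an automorphism of $\mathbb P$ and $\mathcal G=\{\pi_a\mid a\in\operatorname{dom}C_{\mathcal G}\}$ is a group; $\mathcal F$ is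 a normal filter of subgroups of $\mathcal G$ with a base parametrized by sets, i.e. there is a class $C_{\mathcal F}\subseteq V\times\operatorname{dom}C_{\mathcal G}$ such that for every $a\in\operatorname{dom}C_{\mathcal F}$, $H_a=\{\pi_d\mid\langle a,d\rangle\in C_{\mathcal F}\}$ is a subgroup of $\mathcal G$; some $H_b$ equals $\mathcal G$; for all $a,b$ in $\operatorname{dom}C_{\mathcal F}$ there is $c$ in it with $H_c\subseteq H_a\cap H_b$; and for all $a\in\operatorname{dom}C_{\mathcal F}$, $d\in\operatorname{dom}C_{\mathcal G}$ there is $c\in\operatorname{dom}C_{\mathcal F}$ with $H_c\subseteq\pi_dH_a\pi_d^{-1}$. $\mathcal F$ consists of all subgroups $H=\{\pi_b\mid b\in C\}$ of $\mathcal G$, $C$ a class, with $H_a\subseteq H$ for some $a\in\operatorname{dom}C_{\mathcal F}$. Names. A $\mathbb P$-name is a set or class of pairs $\langle\dot y,p\rangle$ with (recursively) $\dot y$ a set-size $\mathbb P$-name and $p\in P$. For $\pi\in\mathcal G$, $\pi(\dot x)=\{\langle\pi(\dot y),\pi(p)\rangle\mid\langle\dot y,p\rangle\in\dot x\}$. $\dot x$ is symmetric if $\{\pi\in\mathcal G\mid\pi(\dot x)=\dot x\}\in\mathcal F$, and hereditarily symmetric (an $\mathcal S$-name) if it is symmetric and recursively every $\dot y\in\operatorname{dom}(\dot x)$ is hereditarily symmetric. $\mathrm{HS}$ is the class of all set-size $\mathcal S$-names. Forcing relation for atomic formulas (for $\mathcal S$). A class relation $\Vdash_0$ such that for all $p\in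 P$, $\dot x,\dot y\in\mathrm{HS}$: (1) $p\Vdash_0\dot x\in\dot y$ iff $\{q\in P\mid\exists\langle\dot z,r\rangle\in\dot y\,(q\le r\wedge q\Vdash_0\dot x=\dot z)\}$ is dense below $p$; (2) $p\Vdash_0\dot x\subseteq\dot y$ iff for every $\langle\dot z,r\rangle\in\dot x$ and every $s\le p,r$ there is $q\le s$ with $q\Vdash_0\dot z\in\dot y$; (3) $p\Vdash_0\dot x=\dot y$ iff $p\Vdash_0\dot x\subseteq\dot y$ and $p\Vdash_0\dot y\subseteq\dot x$. It is unique if it exists. The formulas $p\Vdash^*_{\mathcal S}\varphi$. Given $\Vdash_0$, each formula $\varphi(\vec x,\vec X)$ is mapped metatheoretically to a formula $p\Vdash^*_{\mathcal S}\varphi(\vec x,\vec X)$ (with $q,r,s$ ranging over $P$): $p\Vdash^*_{\mathcal S}x\in y$ is $p\Vdash_0x\in y$; $p\Vdash^*_{\mathcal S}x=y$ is $p\Vdash_0x=y$; $p\Vdash^*_{\mathcal S}x\in X$ is $\forall q\le p\,\exists r\le q\,\exists\langle\dot z,s\rangle\in X\,(r\le s\wedge r\Vdash_0x=\dot z)$; $p\Vdash^*_{\mathcal S}X=Y$ is $p\Vdash^*_{\mathcal S}\forall x(x\in X\leftrightarrow x\in Y)$; $p\Vdash^*_{\mathcal S}\varphi\wedge\psi$ is $(p\Vdash^*_{\mathcal S}\varphi)\wedge(p\Vdash^*_{\mathcal S}\psi)$; $p\Vdash^*_{\mathcal S}\neg\varphi$ is $\forall q\le p\,\neg(q\Vdash^*_{\mathcal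 S}\varphi)$; $p\Vdash^*_{\mathcal S}\exists z\,\varphi$ is $\forall q\le p\,\exists r\le q\,\exists z\in\mathrm{HS}\,(r\Vdash^*_{\mathcal S}\varphi)$. ($\forall,\leftrightarrow$ abbreviate via $\neg,\wedge,\exists$.) Forcing relation for a list of formulas. For formulas $\varphi_1,\dots,\varphi_n$ with a fixed assignment $\vec\Gamma$ of their free class variables to class $\mathcal S$-names (''fixed class $\mathcal S$-name parameters''), a forcing relation for $\mathcal S$ is a class $\Vdash^{\vec\Gamma}_{\mathcal S}$ such that for all $i\in\{1,\dots,n\}$, $p\in P$ and $\vec{\dot x}\in\mathrm{HS}$: $\langle p,\ulcorner\varphi_i\urcorner,\vec{\dot x}\rangle\in\Vdash^{\vec\Gamma}_{\mathcal S}$ iff $p\Vdash^*_{\mathcal S}\varphi_i(\vec{\dot x},\vec\Gamma')$, where $\vec\Gamma'\subseteq\vec\Gamma$ is the assignment to the free class variables of $\varphi_i$ and $\ulcorner\varphi_i\urcorner$ is a fixed code (e.g. Gödel number) of $\varphi_i$. *)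

(* Defs.v *)
From Stdlib Require Import List Arith.
From Stdlib Require Cantor.
Import ListNotations.

(** * First-order formulas of the two-sorted language

    Set variables and class variables are both numbered by [nat]; only set
    variables are quantified. *)

Inductive form : Type :=
| FMem  (x y : nat)   (* x ∈ y, both set variables *)
| FEq   (x y : nat)   (* x = y, both set variables *)
| FCMem (x X : nat)   (* x ∈ X, X a class variable *)
| FCEq  (X Y : nat)   (* X = Y, both class variables *)
| FAnd  (f g : form)
| FNot  (f : form)
| FEx   (x : nat) (f : form).

Fixpoint free_vars (f : form) : list nat :=
  match f with
  | FMem x y | FEq x y => nodup Nat.eq_dec [x; y]
  | FCMem x _ => [x]
  | FCEq _ _ => []
  | FAnd f g => nodup Nat.eq_dec (free_vars f ++ free_vars g)
  | FNot f => free_vars f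
  | FEx x f => remove Nat.eq_dec x (free_vars f)
  end.

Fixpoint class_vars (f : form) : list nat :=
  match f with
  | FMem _ _ | FEq _ _ => []
  | FCMem _ X => [X]
  | FCEq X Y => [X; Y]
  | FAnd f g => class_vars f ++ class_vars g
  | FNot f | FEx _ f => class_vars f
  end.

(** Gödel numbers; [Cantor.to_nat] is a bijection from [nat * nat] to [nat]. *)
Fixpoint goedel (f : form) : nat :=
  match f with
  | FMem x y  => Cantor.to_nat (0, Cantor.to_nat (x, y))
  | FEq x y   => Cantor.to_nat (1, Cantor.to_nat (x, y))
  | FCMem x X => Cantor.to_nat (2, Cantor.to_nat (x, X))
  | FCEq X Y  => Cantor.to_nat (3, Cantor.to_nat (X, Y))
  | FAnd f g  => Cantor.to_nat (4, Cantor.to_nat (goedel f, goedel g))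
  | FNot f    => Cantor.to_nat (5, goedel f)
  | FEx x f   => Cantor.to_nat (6, Cantor.to_nat (x, goedel f))
  end.

Definition upd {T : Type} (e : nat -> T) (n : nat) (v : T) : nat -> T :=
  fun k => if Nat.eq_dec k n then v else e k.

(** * Models of GB *)

Record structure : Type := Structure {
  gset : Type;
  gclass : Type;
  mem : gset -> gset -> Prop;
  cmem : gset -> gclass -> Prop
}.

Arguments mem {_}.
Arguments cmem {_}.

Section Structures.
Context {M : structure}.
Notation V := (gset M).
Notation C := (gclass M).
Implicit Types (x y z u v w a b c d p q r s t f : V) (A R X : C).

Fixpoint sat (e : nat -> V) (G : nat -> C) (phi : form) : Prop :=
  match phi with
  | FMem i j => mem (e i) (e j)
  | FEq i j => e i = e j
  | FCMem i k => cmem (e i) (G k)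
  | FCEq k l => G k = G l
  | FAnd phi psi => sat e G phi /\ sat e G psi
  | FNot phi => ~ sat e G phi
  | FEx i phi => exists z, sat (upd e i z) G phi
  end.

(** Set-theoretic terms are relations whose first argument is the value:
    [is_opair z x y] says [z = ⟨x,y⟩] (Kuratowski). *)

Definition is_empty z := forall w, ~ mem w z.
Definition is_upair z x y := forall w, mem w z <-> w = x \/ w = y.
Definition is_opair z x y :=
  forall w, mem w z <-> is_upair w x x \/ is_upair w x y.
Definition is_succ z y := forall w, mem w z <-> mem w y \/ w = y.

Fixpoint is_numeral z (n : nat) : Prop :=
  match n with
  | 0 => is_empty z
  | S n => exists y, is_numeral y n /\ is_succ z y
  end.

(** [⟨x1,…,xk⟩] is [⟨x1,⟨x2,…⟨xk,∅⟩…⟩⟩]. *)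
Fixpoint is_tuple z (l : list V) : Prop :=
  match l with
  | [] => is_empty z
  | x :: l => exists t, is_tuple t l /\ is_opair z x t
  end.

Definition pair_mem x y z := exists w, is_opair w x y /\ mem w z.
Definition pair_cmem x y A := exists w, is_opair w x y /\ cmem w A.
(** [⟨x,⟨y,z⟩⟩ ∈ A]. *)
Definition triple_cmem x y z A := exists w, is_opair w y z /\ pair_cmem x w A.

Definition in_cdom x A := exists y, pair_cmem x y A.

(** Class existence is comprehension for first-order formulas, with set and
    class parameters. *)
Record GB : Prop := {
  gb_ext : forall x y, (forall w, mem w x <-> mem w y) -> x = y;
  gb_class_ext : forall A B : C, (forall w, cmem w A <-> cmem w B) -> A = B;
  gb_regularity : forall x, (exists w, mem w x) ->
    exists y, mem y x /\ forall w, ~ (mem w x /\ mem w y);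
  gb_pairing : forall x y, exists z, is_upair z x y;
  gb_union : forall x, exists u, forall w, mem w u <-> exists y, mem y x /\ mem w y;
  gb_infinity : exists x, (exists y, is_empty y /\ mem y x) /\
    forall y, mem y x -> exists z, is_succ z y /\ mem z x;
  gb_powerset : forall x, exists z,
    forall y, mem y z <-> forall w, mem w y -> mem w x;
  gb_set_class : forall x, exists A, forall w, cmem w A <-> mem w x;
  gb_separation : forall x A, exists z, forall w, mem w z <-> mem w x /\ cmem w A;
  gb_collection : forall a R,
    (forall x, mem x a -> exists y, pair_cmem x y R) ->
    exists b, forall x, mem x a -> exists y, mem y b /\ pair_cmem x y R;
  gb_comprehension : forall (phi : form) (i : nat) (e : nat -> V) (G : nat -> C),
    exists A, forall x, cmem x A <-> sat (upd e i x) G phi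
}.

End Structures.

Arguments GB : clear implicits.

(** * Class symmetric systems *)

Record system (M : structure) : Type := System {
  sP : gclass M;
  sle : gclass M;
  sone : gset M;
  sG : gclass M;   (* C_G: triples ⟨a,⟨p,q⟩⟩ with π_a(p) = q *)
  sF : gclass M    (* C_F: pairs ⟨a,d⟩ with π_d in H_a *)
}.

Section Systems.
Context {M : structure} (S : system M).
Notation V := (gset M).
Notation C := (gclass M).
Implicit Types (x y z u v w a b c d p q r s t f : V) (A R X : C).

Definition inP p := cmem p (sP M S).
Definition le p q := pair_cmem p q (sle M S).
Definition domG a := in_cdom a (sG M S).
Definition domF a := in_cdom a (sF M S).

(** [perm a p q] is [π_a(p) = q]. *)
Definition perm a p q := triple_cmem a p q (sG M S).

Definition is_preorder : Prop :=
  (forall w, cmem w (sle M S) -> exists p q, is_opair w p q /\ inP p /\ inP q) /\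
  (forall p, inP p -> le p p) /\
  (forall p q r, le p q -> le q r -> le p r) /\
  inP (sone M S) /\
  (forall p, inP p -> le p (sone M S)).

Definition is_automorphism (f : V -> V -> Prop) : Prop :=
  (forall p q, f p q -> inP p /\ inP q) /\
  (forall p, inP p -> exists! q, f p q) /\
  (forall q, inP q -> exists! p, f p q) /\
  (forall p q p' q', f p p' -> f q q' -> (le p q <-> le p' q')).

(** Automorphisms are given by indices, distinct indices possibly giving the
    same one.  A set [H] of automorphisms is given by a predicate [D] on indices,
    [H = {π_b | D b}]. *)

Definition perm_is a (f : V -> V -> Prop) := forall p q, perm a p q <-> f p q.
Definition perm_eq a b := perm_is a (perm b).

Definition perm_in a (D : V -> Prop) := exists b, D b /\ perm_eq a b.
Definition perms_sub (D E : V -> Prop) := forall a, D a -> perm_in a E.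
Definition perms_eq (D E : V -> Prop) := perms_sub D E /\ perms_sub E D.

Definition is_perm_group (D : V -> Prop) : Prop :=
  (exists c, D c /\ perm_is c (fun p q => inP p /\ p = q)) /\
  (forall a b, D a -> D b ->
     exists c, D c /\ perm_is c (fun p q => exists r, perm b p r /\ perm a r q)) /\
  (forall a, D a -> exists c, D c /\ perm_is c (fun p q => perm a q p)).

Definition is_subgroup (D : V -> Prop) : Prop :=
  (forall a, D a -> domG a) /\ is_perm_group D.

(** The index set of [H_a]. *)
Definition baseF a d := pair_cmem a d (sF M S).

Definition is_automorphism_group : Prop :=
  (forall w, cmem w (sG M S) ->
     exists a u p q, is_opair u p q /\ is_opair w a u /\ inP p /\ inP q) /\
  (forall a, domG a -> is_automorphism (perm a)) /\
  is_perm_group domG.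

Definition is_normal_filter_base : Prop :=
  (forall w, cmem w (sF M S) -> exists a d, is_opair w a d /\ domG d) /\
  (forall a, domF a -> is_subgroup (baseF a)) /\
  (exists b, domF b /\ perms_eq (baseF b) domG) /\
  (forall a b, domF a -> domF b ->
     exists c, domF c /\ forall d, baseF c d ->
       perm_in d (baseF a) /\ perm_in d (baseF b)) /\
  (forall a d, domF a -> domG d ->
     exists c, domF c /\ forall e, baseF c e ->
       exists h, baseF a h /\
         perm_is e (fun p q => exists r s, perm d r p /\ perm h r s /\ perm d s q)).

Definition class_symmetric_system : Prop :=
  is_preorder /\ is_automorphism_group /\ is_normal_filter_base.

(** [{π_b | b ∈ A} ∈ F]. *)
Definition in_filter A : Prop :=
  is_subgroup (fun b => cmem b A) /\
  exists a, domF a /\ perms_sub (baseF a) (fun b => cmem b A).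

(** * Names

    A structure satisfying GB need not be well-founded from outside, so the
    recursive definitions are carried out inside it: a recursive predicate holds
    at [x] if a set containing [x] witnesses it, and a recursive function has
    value [y] at [x] if some set function satisfying the recursion takes [x] to
    [y]. *)

Definition is_name x : Prop :=
  exists t, mem x t /\
    forall y, mem y t -> forall w, mem w y ->
      exists z p, is_opair w z p /\ mem z t /\ inP p.

Definition is_action_attempt a f : Prop :=
  (forall w, mem w f -> exists x y, is_opair w x y) /\
  (forall x y y', pair_mem x y f -> pair_mem x y' f -> y = y') /\
  (forall x y, pair_mem x y f ->
     (forall z p, pair_mem z p x -> exists z', pair_mem z z' f) /\
     (forall w, mem w y <->
        exists z p z' p', pair_mem z p x /\ pair_mem z z' f /\ perm a p p' /\
                          is_opair w z' p')).

(** [π_a(x) = y]. *)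
Definition act a x y : Prop :=
  exists f, is_action_attempt a f /\ pair_mem x y f.

(** [π_a(X) = X]. *)
Definition fixes_class a X : Prop :=
  forall w, cmem w X <->
    exists z p z' p', pair_cmem z p X /\ act a z z' /\ perm a p p' /\
                      is_opair w z' p'.

Definition symmetric x : Prop :=
  exists A, (forall a, cmem a A <-> domG a /\ act a x x) /\ in_filter A.

Definition symmetric_class X : Prop :=
  exists A, (forall a, cmem a A <-> domG a /\ fixes_class a X) /\ in_filter A.

(** Together with [symmetric], the last clause makes every member of [t] a
    name. *)
Definition HS x : Prop :=
  exists t, mem x t /\
    forall y, mem y t ->
      symmetric y /\
      forall w, mem w y -> exists z p, is_opair w z p /\ mem z t /\ inP p.

Definition class_name X : Prop :=
  forall w, cmem w X -> exists z p, is_opair w z p /\ is_name z /\ inP p.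

Definition class_S_name X : Prop :=
  class_name X /\ symmetric_class X /\ forall z, in_cdom z X -> HS z.

(** * Forcing *)

(** The relation for atomic formulas is one class of tuples
    [⟨p,⟨c,⟨x,y⟩⟩⟩], where [c] is 0, 1, 2 for [∈], [⊆], [=]. *)
Definition forces0 (F0 : C) (k : nat) p x y : Prop :=
  exists c u, is_numeral c k /\ is_opair u x y /\ triple_cmem p c u F0.

Definition forces_in F0 := forces0 F0 0.
Definition forces_sub F0 := forces0 F0 1.
Definition forces_eq F0 := forces0 F0 2.

Definition dense_below (D : V -> Prop) p : Prop :=
  forall q, inP q -> le q p -> exists r, inP r /\ le r q /\ D r.

Definition atomic_forcing_relation (F0 : C) : Prop :=
  forall p x y, inP p -> HS x -> HS y ->
    (forces_in F0 p x y <->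
       dense_below (fun q => exists z r, pair_mem z r y /\ le q r /\
                                         forces_eq F0 q x z) p) /\
    (forces_sub F0 p x y <->
       forall z r, pair_mem z r x ->
       forall s, inP s -> le s p -> le s r ->
       exists q, inP q /\ le q s /\ forces_in F0 q z y) /\
    (forces_eq F0 p x y <-> forces_sub F0 p x y /\ forces_sub F0 p y x).

(** Clauses for [¬], [∧], [∃] acting on [fun p => (p ⊩ φ)], and their
    abbreviations. *)
Definition fc_not (A : V -> Prop) : V -> Prop :=
  fun p => forall q, inP q -> le q p -> ~ A q.
Definition fc_and (A B : V -> Prop) : V -> Prop := fun p => A p /\ B p.
Definition fc_ex (A : V -> V -> Prop) : V -> Prop :=
  fun p => forall q, inP q -> le q p ->
    exists r, inP r /\ le r q /\ exists z, HS z /\ A z r.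
Definition fc_imp (A B : V -> Prop) := fc_not (fc_and A (fc_not B)).
Definition fc_iff (A B : V -> Prop) := fc_and (fc_imp A B) (fc_imp B A).
Definition fc_all (A : V -> V -> Prop) := fc_not (fc_ex (fun z => fc_not (A z))).

Definition forces_cmem (F0 : C) x X : V -> Prop :=
  fun p => forall q, inP q -> le q p ->
    exists r, inP r /\ le r q /\
      exists z s, pair_cmem z s X /\ le r s /\ forces_eq F0 r x z.

(** [forces_star F0 e G phi p] is the truth value in the structure of the formula
    [p ⊩* φ] under the assignments [e], [G]. *)
Fixpoint forces_star (F0 : C) (e : nat -> V) (G : nat -> C) (phi : form)
  : V -> Prop :=
  match phi with
  | FMem i j => fun p => forces_in F0 p (e i) (e j)
  | FEq i j => fun p => forces_eq F0 p (e i) (e j)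
  | FCMem i k => forces_cmem F0 (e i) (G k)
  | FCEq k l => fc_all (fun z => fc_iff (forces_cmem F0 z (G k))
                                        (forces_cmem F0 z (G l)))
  | FAnd phi psi => fc_and (forces_star F0 e G phi) (forces_star F0 e G psi)
  | FNot phi => fc_not (forces_star F0 e G phi)
  | FEx i phi => fc_ex (fun z => forces_star F0 (upd e i z) G phi)
  end.

(** [⟨p,⟨⌜φ⌝,⟨x1,…,xk⟩⟩⟩ ∈ F], where [x1,…,xk] are the values under [e] of the
    free set variables of [φ]. *)
Definition forcing_code_mem (F : C) p (phi : form) (e : nat -> V) : Prop :=
  exists c t, is_numeral c (goedel phi) /\ is_tuple t (map e (free_vars phi)) /\
              triple_cmem p c t F.

Definition forcing_relation (F0 : C) (phis : list form) (G : nat -> C) (F : C)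
  : Prop :=
  forall phi, In phi phis ->
  forall p, inP p ->
  forall e : nat -> V, (forall i, In i (free_vars phi) -> HS (e i)) ->
    (forcing_code_mem F p phi e <-> forces_star F0 e G phi p).

End Systems.

(* Main.v *)
Require Import Defs.
From Stdlib Require Import List Arith Lia.
From Stdlib Require Import Classical FunctionalExtensionality PropExtensionality.
From Stdlib Require Cantor.
Import ListNotations.

(** For a fixed formula [phi], the recursion defining [p ⊩* phi] is carried out
    outside the model and has finitely many steps.  Each step is a first-order
    construction over the classes [P], [≤], [C_G], [C_F], [F0] and the class
    parameters, so [p ⊩* phi] is itself expressed by a first-order formula in
    [p] and the values of the free variables of [phi]
    ([definable_forces_star]).  The one ingredient that is not visibly first
    order is [HS], because symmetry of a name asks for a class in the filter;
    but that class must be the stabilizer of the name, which is definable and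
    hence exists ([symmetric_iff]).

    Numerals of standard numbers and tuples of standard length are definable
    too, so class comprehension, applied to the disjunction over the finite
    list, yields the class of all [⟨p,⟨⌜phi⌝,xs⟩⟩] with [p ⊩* phi(xs)].  That this
    class is a forcing relation rests on unique decoding: ordered pairs
    determine their components ([is_opair_inj]), distinct standard numbers have
    distinct numerals ([is_numeral_inj]), distinct formulas have distinct
    numbers ([goedel_inj]), and [p ⊩* phi] depends only on the values of the
    free variables ([forces_star_ext]).

    Definability is handled semantically, as a property of predicates on
    assignments ([definable]), with one closure rule for each logical
    connective; quantifiers follow the de Bruijn convention
    ([definable_ex]). *)

(** * Satisfaction under changes of assignment *)

Lemma sat_ext {M : structure} (phi : form) :
  forall (e e' : nat -> gset M) (G G' : nat -> gclass M),
  (forall i, In i (free_vars phi) -> e i = e' i) -> (forall k, G k = G' k) ->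
  sat e G phi <-> sat e' G' phi.
Proof.
  induction phi as [x y|x y|x X|X Y|f IHf g IHg|f IHf|x f IHf];
    simpl; intros e e' G G' He HG.
  - rewrite !He by (apply (nodup_In Nat.eq_dec [x; y]); simpl; auto). tauto.
  - rewrite !He by (apply (nodup_In Nat.eq_dec [x; y]); simpl; auto). tauto.
  - rewrite He, HG by auto. tauto.
  - rewrite !HG. tauto.
  - rewrite (IHf e e' G G'), (IHg e e' G G'); [tauto| |auto| |auto];
      intros i Hi; apply He, nodup_In, in_or_app; auto.
  - rewrite (IHf e e' G G') by auto. tauto.
  - assert (H : forall z, sat (upd e x z) G f <-> sat (upd e' x z) G' f).
    { intros z. apply IHf; auto. intros i Hi. unfold upd.
      destruct (Nat.eq_dec i x); auto. apply He, in_in_remove; auto. }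
    split; intros [z Hz]; exists z; apply H, Hz.
Qed.

Definition fresh_var (l : list nat) : nat := S (list_max l).

Lemma in_lt_fresh_var (l : list nat) (i : nat) : In i l -> i < fresh_var l.
Proof.
  intros Hi. unfold fresh_var. apply Nat.lt_succ_r.
  pose proof (proj1 (list_max_le l (list_max l)) (le_n _)) as H.
  rewrite Forall_forall in H. auto.
Qed.

(** Renaming set and class variables is what lets formulas found separately be
    put under a common assignment of class parameters, and de Bruijn indices be
    replaced by names.  As [f] need not be injective, each bound variable is
    moved away from the images under [f] of the free ones. *)
Lemma sat_rename (M : structure) (phi : form) :
  forall f g : nat -> nat, exists psi, forall (e : nat -> gset M) (G : nat -> gclass M),
  sat e G psi <-> sat (fun i => e (f i)) (fun k => G (g k)) phi.
Proof.
  induction phi as [x y|x y|x X|X Y|f1 IHf g1 IHg|f1 IHf|x f1 IHf]; intros f g.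
  - exists (FMem (f x) (f y)). reflexivity.
  - exists (FEq (f x) (f y)). reflexivity.
  - exists (FCMem (f x) (g X)). reflexivity.
  - exists (FCEq (g X) (g Y)). reflexivity.
  - destruct (IHf f g) as [a Ha], (IHg f g) as [b Hb].
    exists (FAnd a b). intros e G. simpl. rewrite Ha, Hb. reflexivity.
  - destruct (IHf f g) as [a Ha].
    exists (FNot a). intros e G. simpl. rewrite Ha. reflexivity.
  - set (j := fresh_var (map f (free_vars f1))).
    destruct (IHf (upd f x j) g) as [a Ha].
    exists (FEx j a). intros e G. simpl.
    assert (H : forall z, sat (upd e j z) G a <->
              sat (upd (fun i => e (f i)) x z) (fun k => G (g k)) f1).
    { intros z. rewrite Ha. apply sat_ext; auto. intros i Hi. unfold upd.
      destruct (Nat.eq_dec i x); destruct (Nat.eq_dec _ j) as [E|E]; try congruence.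
      exfalso. pose proof (in_lt_fresh_var _ _ (in_map f _ _ Hi)). fold j in H. lia. }
    split; intros [z Hz]; exists z; apply H, Hz.
Qed.

(** * Definable predicates of assignments *)

Definition definable {M : structure} (P : (nat -> gset M) -> Prop) : Prop :=
  exists (phi : form) (G : nat -> gclass M), forall e, sat e G phi <-> P e.

(** Arguments of definable predicates are terms [t e] depending on the
    assignment [e]; the only terms of the language are variables. *)
Definition is_var {M : structure} (t : (nat -> gset M) -> gset M) : Prop :=
  exists k, forall e, t e = e k.

Section Definability.
Context {M : structure} (HM : GB M).
Implicit Types (P Q : (nat -> gset M) -> Prop) (s t u : (nat -> gset M) -> gset M).

Lemma definable_iff P Q : (forall e, P e <-> Q e) -> definable P -> definable Q.
Proof.
  intros H [phi [G HP]]. exists phi, G. intros e. rewrite HP. apply H.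
Qed.

Lemma class_inhabited : inhabited (gclass M).
Proof.
  destruct (gb_infinity HM) as [x _]. destruct (gb_set_class HM x) as [A _].
  exact (inhabits A).
Qed.

Lemma definable_mem s t : is_var s -> is_var t -> definable (fun e => mem (s e) (t e)).
Proof.
  intros [i Hi] [j Hj]. destruct class_inhabited as [A].
  exists (FMem i j), (fun _ => A). intros e. simpl. rewrite Hi, Hj. tauto.
Qed.

Lemma definable_eq s t : is_var s -> is_var t -> definable (fun e => s e = t e).
Proof.
  intros [i Hi] [j Hj]. destruct class_inhabited as [A].
  exists (FEq i j), (fun _ => A). intros e. simpl. rewrite Hi, Hj. tauto.
Qed.

Lemma definable_cmem s A : is_var s -> definable (fun e => cmem (s e) A).
Proof.
  intros [i Hi]. exists (FCMem i 0), (fun _ => A). intros e. simpl. rewrite Hi. tauto.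
Qed.

Lemma definable_not P : definable P -> definable (fun e => ~ P e).
Proof.
  intros [phi [G H]]. exists (FNot phi), G. intros e. simpl. rewrite H. tauto.
Qed.

(** The class parameters of the two formulas are interleaved by the pairing
    function. *)
Lemma definable_and P Q : definable P -> definable Q -> definable (fun e => P e /\ Q e).
Proof.
  intros [phi [G HP]] [psi [G' HQ]].
  destruct (sat_rename M phi (fun i => i) (fun k => Cantor.to_nat (0, k))) as [a Ha].
  destruct (sat_rename M psi (fun i => i) (fun k => Cantor.to_nat (1, k))) as [b Hb].
  exists (FAnd a b),
    (fun n => let (c, k) := Cantor.of_nat n in match c with 0 => G k | _ => G' k end).
  intros e. simpl. rewrite Ha, Hb, <- HP, <- HQ.
  rewrite (sat_ext phi (fun i => e i) e _ G), (sat_ext psi (fun i => e i) e _ G');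
    [reflexivity| | | |]; auto; intros k; now rewrite Cantor.cancel_of_to.
Qed.

Lemma definable_or P Q : definable P -> definable Q -> definable (fun e => P e \/ Q e).
Proof.
  intros HP HQ. apply definable_iff with (fun e => ~ (~ P e /\ ~ Q e)).
  - intros e. tauto.
  - auto using definable_not, definable_and.
Qed.

Lemma definable_imp P Q : definable P -> definable Q -> definable (fun e => P e -> Q e).
Proof.
  intros HP HQ. apply definable_iff with (fun e => ~ (P e /\ ~ Q e)).
  - intros e. tauto.
  - auto using definable_not, definable_and.
Qed.

(** Quantification over a de Bruijn variable: the bound variable becomes
    variable 0 and the others move up by one.  The formula quantifies a fresh
    named variable instead. *)
Lemma definable_ex (Q : (nat -> gset M) -> gset M -> Prop) :
  definable (fun e => Q (fun n => e (S n)) (e 0)) -> definable (fun e => exists z, Q e z).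
Proof.
  intros [phi [G H]]. set (N := fresh_var (free_vars phi)).
  destruct (sat_rename M phi (fun n => match n with 0 => N | S n => n end) (fun k => k))
    as [psi Hpsi].
  exists (FEx N psi), G. intros e. simpl.
  assert (E : forall z, sat (upd e N z) G psi <-> Q e z).
  { intros z. rewrite Hpsi.
    rewrite (sat_ext phi _ (fun n => match n with 0 => z | S n => e n end) _ G).
    - apply H.
    - intros i Hi. apply in_lt_fresh_var in Hi. fold N in Hi. unfold upd.
      destruct i, (Nat.eq_dec _ N); try lia; auto.
    - reflexivity. }
  split; intros [z Hz]; exists z; apply E, Hz.
Qed.

Lemma definable_all (Q : (nat -> gset M) -> gset M -> Prop) :
  definable (fun e => Q (fun n => e (S n)) (e 0)) -> definable (fun e => forall z, Q e z).
Proof.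
  intros HQ. apply definable_iff with (fun e => ~ exists z, ~ Q e z).
  - intros e. split; intros H.
    + intros z. apply NNPP. eauto.
    + intros [z Hz]. auto.
  - apply definable_not, definable_ex, definable_not, HQ.
Qed.

Lemma definable_False : definable (fun _ : nat -> gset M => False).
Proof.
  destruct class_inhabited as [A].
  exists (FAnd (FEq 0 0) (FNot (FEq 0 0))), (fun _ => A). intros e. simpl. tauto.
Qed.

Lemma comprehension P (e : nat -> gset M) :
  definable P ->
  exists A, forall x, cmem x A <-> P (fun n => match n with 0 => x | S n => e n end).
Proof.
  intros [phi [G H]].
  destruct (gb_comprehension HM phi 0 (fun n => e (pred n)) G) as [A HA].
  exists A. intros x. rewrite HA, <- H. apply sat_ext; auto.
  intros [|i] _; reflexivity.
Qed.

(** Only finitely many variables matter to a formula, so quantifying over an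
    entire assignment amounts to a finite block of set quantifiers. *)
Lemma comprehension_projection P :
  definable P -> exists A, forall x, cmem x A <-> exists e, e 0 = x /\ P e.
Proof.
  intros [phi [G H]]. set (N := fresh_var (free_vars phi)).
  assert (B : forall n, exists psi, forall e, sat e G psi <->
            exists e', (forall i, i = 0 \/ n < i -> e' i = e i) /\ sat e' G phi).
  { induction n as [|n [psi Hpsi]].
    - exists phi. intros e. split.
      + intros Hs. exists e. auto.
      + intros [e' [He Hs]]. apply (sat_ext phi e e' G G); auto.
        intros [|i] _; symmetry; apply He; lia.
    - exists (FEx (S n) psi). intros e. simpl. split.
      + intros [z Hz]. apply Hpsi in Hz. destruct Hz as [e' [He Hs]].
        exists e'. split; [|exact Hs]. intros i Hi. rewrite He by lia. unfold upd.
        destruct (Nat.eq_dec i (S n)); [lia|reflexivity].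
      + intros [e' [He Hs]]. exists (e' (S n)). apply Hpsi.
        exists e'. split; [|exact Hs]. intros i Hi. unfold upd.
        destruct (Nat.eq_dec i (S n)); [congruence|]. apply He. lia. }
  (* Variable 0 stays free and receives the element of the class. *)
  destruct (B N) as [psi Hpsi], (gb_infinity HM) as [x0 _].
  destruct (gb_comprehension HM psi 0 (fun _ => x0) G) as [A HA].
  exists A. intros x. rewrite HA, Hpsi. split; intros [e [He Hs]].
  - exists e. rewrite He by auto. split; [reflexivity|]. apply H, Hs.
  - exists (fun i => if le_lt_dec i N then e i else x0). split.
    + intros i Hi. unfold upd. destruct (le_lt_dec i N), (Nat.eq_dec i 0); subst;
        auto; lia.
    + apply H in Hs. revert Hs. apply sat_ext; auto. intros i Hi.
      apply in_lt_fresh_var in Hi. fold N in Hi. destruct (le_lt_dec i N); [auto|lia].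
Qed.

End Definability.

(** A term under quantifiers is still a variable, whose index counts the
    quantifiers passed. *)
Ltac solve_var :=
  first
  [ solve [eexists; intro; reflexivity]
  | match goal with
    | H : is_var ?t |- _ =>
        let k := fresh "k" in
        solve [destruct H as [k H]; eexists; intro; rewrite H; reflexivity]
    | H : forall i, is_var _ |- is_var (fun e => _ ?j) =>
        let k := fresh "k" in
        solve [destruct (H j) as [k Hk]; eexists; intro; rewrite Hk; reflexivity]
    end ].

Create HintDb definable.

(** Follows the logical structure of a predicate down to the notions whose
    definability is recorded in the hint database. *)
Ltac define_step :=
  cbn beta;
  lazymatch goal with
  | |- is_var _ => solve_var
  | |- GB _ => assumption
  | |- definable (fun e => @?P e /\ @?Q e) => apply definable_and
  | |- definable (fun e => @?P e \/ @?Q e) => apply definable_or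
  | |- definable (fun e => @?P e <-> @?Q e) => unfold iff
  | |- definable (fun e => ~ @?P e) => apply definable_not
  | |- definable (fun e => exists z, @?Q e z) => apply definable_ex
  | |- definable (fun e => @?P e -> @?Q e) => apply definable_imp
  | |- definable (fun e => forall z, @?Q e z) => apply definable_all
  | |- definable (fun e => mem _ _) => apply definable_mem
  | |- definable (fun e => cmem _ _) => apply definable_cmem
  | |- definable (fun e => _ = _ :> gset _) => apply definable_eq
  | |- definable _ => solve [eauto with definable nocore]
  end.
Ltac define := intros; repeat define_step.

#[local] Hint Extern 0 (is_var _) => solve_var : definable.

(** * Definability of forcing *)

Section ForcingDefinability.
Context {M : structure} (HM : GB M) (Sys : system M).
Implicit Types (s t u : (nat -> gset M) -> gset M) (A : gclass M).

Lemma definable_is_upair t s u : is_var t -> is_var s -> is_var u ->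
  definable (fun e => is_upair (t e) (s e) (u e)).
Proof. unfold is_upair. define. Qed.
#[local] Hint Resolve definable_is_upair : definable.

Lemma definable_is_opair t s u : is_var t -> is_var s -> is_var u ->
  definable (fun e => is_opair (t e) (s e) (u e)).
Proof. unfold is_opair. define. Qed.
#[local] Hint Resolve definable_is_opair : definable.

Lemma definable_is_numeral n : forall t, is_var t ->
  definable (fun e => is_numeral (t e) n).
Proof.
  induction n; simpl; unfold is_empty, is_succ; define.
Qed.
#[local] Hint Resolve definable_is_numeral : definable.

Lemma definable_is_tuple (eps : (nat -> gset M) -> nat -> gset M) l :
  (forall i, is_var (fun e => eps e i)) ->
  forall t, is_var t -> definable (fun e => is_tuple (t e) (map (eps e) l)).
Proof.
  intros H. revert eps H. induction l as [|i l IH]; simpl; intros eps H t Ht;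
    unfold is_empty; define.
Qed.
#[local] Hint Resolve definable_is_tuple : definable.

Lemma definable_pair_mem t s u : is_var t -> is_var s -> is_var u ->
  definable (fun e => pair_mem (t e) (s e) (u e)).
Proof. unfold pair_mem. define. Qed.
#[local] Hint Resolve definable_pair_mem : definable.

Lemma definable_pair_cmem t s A : is_var t -> is_var s ->
  definable (fun e => pair_cmem (t e) (s e) A).
Proof. unfold pair_cmem. define. Qed.
#[local] Hint Resolve definable_pair_cmem : definable.

Lemma definable_triple_cmem t s u A : is_var t -> is_var s -> is_var u ->
  definable (fun e => triple_cmem (t e) (s e) (u e) A).
Proof. unfold triple_cmem. define. Qed.
#[local] Hint Resolve definable_triple_cmem : definable.

Lemma definable_inP t : is_var t -> definable (fun e => inP Sys (t e)).
Proof. unfold inP. define. Qed.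
#[local] Hint Resolve definable_inP : definable.

Lemma definable_le s t : is_var s -> is_var t -> definable (fun e => le Sys (s e) (t e)).
Proof. unfold le. define. Qed.
#[local] Hint Resolve definable_le : definable.

Lemma definable_domG t : is_var t -> definable (fun e => domG Sys (t e)).
Proof. unfold domG, in_cdom. define. Qed.
#[local] Hint Resolve definable_domG : definable.

Lemma definable_perm s t u : is_var s -> is_var t -> is_var u ->
  definable (fun e => perm Sys (s e) (t e) (u e)).
Proof. unfold perm. define. Qed.
#[local] Hint Resolve definable_perm : definable.

Lemma definable_act s t u : is_var s -> is_var t -> is_var u ->
  definable (fun e => act Sys (s e) (t e) (u e)).
Proof. unfold act, is_action_attempt. define. Qed.
#[local] Hint Resolve definable_act : definable.

(** The class quantifier in [symmetric] is only apparent: its witness can only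
    be the stabilizer, which is definable and therefore always a class. *)
Lemma symmetric_iff (x : gset M) :
  let D := fun a => domG Sys a /\ act Sys a x x in
  symmetric Sys x <->
  is_subgroup Sys D /\ exists a, domF Sys a /\ perms_sub Sys (baseF Sys a) D.
Proof.
  intros D. unfold symmetric, in_filter.
  assert (HD : exists A, forall a, cmem a A <-> D a).
  { apply (comprehension HM (fun e => domG Sys (e 0) /\ act Sys (e 0) (e 1) (e 1))
             (fun _ => x)).
    define. }
  assert (E : forall A, (forall a, cmem a A <-> D a) -> (fun a => cmem a A) = D).
  { intros A HA. extensionality a. apply propositional_extensionality, HA. }
  split.
  - intros [A [HA HF]]. rewrite (E A HA) in HF. exact HF.
  - intros HF. destruct HD as [A HA]. exists A. rewrite (E A HA). auto.
Qed.

Lemma definable_symmetric t : is_var t -> definable (fun e => symmetric Sys (t e)).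
Proof.
  intros Ht. eapply definable_iff.
  { intros e. symmetry. apply symmetric_iff. }
  unfold is_subgroup, is_perm_group, perms_sub, perm_in, perm_eq, perm_is, domF, baseF,
    in_cdom.
  define.
Qed.
#[local] Hint Resolve definable_symmetric : definable.

Lemma definable_HS t : is_var t -> definable (fun e => HS Sys (t e)).
Proof. unfold HS. define. Qed.
#[local] Hint Resolve definable_HS : definable.

Lemma definable_forces0 A k s t u : is_var s -> is_var t -> is_var u ->
  definable (fun e => forces0 A k (s e) (t e) (u e)).
Proof. unfold forces0. define. Qed.
#[local] Hint Resolve definable_forces0 : definable.

Lemma definable_forces_cmem F0 A s t : is_var s -> is_var t ->
  definable (fun e => forces_cmem Sys F0 (s e) A (t e)).
Proof. unfold forces_cmem, forces_eq. define. Qed.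
#[local] Hint Resolve definable_forces_cmem : definable.

(** The assignment given to [forces_star] changes at quantifiers and its
    ambient variables are renumbered, hence the general family [eps] of
    variables. *)
Lemma definable_forces_star F0 G phi :
  forall (eps : (nat -> gset M) -> nat -> gset M) t,
  (forall i, is_var (fun e => eps e i)) -> is_var t ->
  definable (fun e => forces_star Sys F0 (eps e) G phi (t e)).
Proof.
  induction phi as [x y|x y|x X|X Y|f IHf g IHg|f IHf|x f IHf]; simpl;
    unfold fc_all, fc_iff, fc_imp, fc_and, fc_ex, fc_not, forces_in, forces_eq;
    intros eps t Heps Ht.
  all: define.
  apply (IHf (fun e => upd (eps (fun n => e (S (S (S n))))) x (e 0))); define.
  unfold upd. destruct (Nat.eq_dec i x); define.
Qed.

(** The value of variable [S i] plays the part of the set variable [i] of the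
    formulas, and the value of variable 0 is the coded tuple. *)
Definition forcing_code (F0 : gclass M) (G : nat -> gclass M) (phi : form)
    (e : nat -> gset M) : Prop :=
  exists p c t u : gset M, is_numeral c (goedel phi) /\
    is_tuple t (map (fun i => e (S i)) (free_vars phi)) /\
    is_opair u c t /\ is_opair (e 0) p u /\
    forces_star Sys F0 (fun i => e (S i)) G phi p.

Lemma definable_forcing_code F0 G phi : definable (forcing_code F0 G phi).
Proof.
  unfold forcing_code. define.
  apply (definable_forces_star F0 G phi (fun e i => e (S (S (S (S (S i))))))); define.
Qed.

End ForcingDefinability.

(** * Unique decoding of the tuples in a forcing relation *)

Section Coding.
Context {M : structure} (HM : GB M).
Implicit Types (x y z c t : gset M).

Lemma is_upair_inj_same w x x' : is_upair w x x -> is_upair w x' x' -> x = x'.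
Proof.
  intros H H'. destruct (proj1 (H' x) (proj2 (H x) (or_introl eq_refl))); auto.
Qed.

Lemma is_opair_inj z x y x' y' : is_opair z x y -> is_opair z x' y' -> x = x' /\ y = y'.
Proof.
  intros H H'.
  destruct (gb_pairing HM x x) as [s Hs], (gb_pairing HM x y) as [d Hd],
    (gb_pairing HM x' y') as [d' Hd'].
  assert (Ex : x = x').
  { destruct (proj1 (H' s) (proj2 (H s) (or_introl Hs))) as [K|K].
    - exact (is_upair_inj_same _ _ _ Hs K).
    - destruct (proj1 (Hs x') (proj2 (K x') (or_introl eq_refl))); auto. }
  subst x'. split; [reflexivity|].
  assert (Ed : y = x \/ y = y').
  { destruct (proj1 (H' d) (proj2 (H d) (or_intror Hd))) as [K|K];
      destruct (proj1 (K y) (proj2 (Hd y) (or_intror eq_refl))); auto. }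
  assert (Ed' : y' = x \/ y' = y).
  { destruct (proj1 (H d') (proj2 (H' d') (or_intror Hd'))) as [K|K];
      destruct (proj1 (K y') (proj2 (Hd' y') (or_intror eq_refl))); auto. }
  intuition congruence.
Qed.

Lemma is_opair_exists x y : exists z, is_opair z x y.
Proof.
  destruct (gb_pairing HM x x) as [s Hs], (gb_pairing HM x y) as [d Hd],
    (gb_pairing HM s d) as [z Hz].
  exists z. intros w. rewrite (Hz w). split.
  - intros [->| ->]; auto.
  - intros [K|K]; [left|right]; apply (gb_ext HM); intros v.
    + rewrite (K v), (Hs v). reflexivity.
    + rewrite (K v), (Hd v). reflexivity.
Qed.

Lemma is_empty_exists : exists z : gset M, is_empty z.
Proof. destruct (gb_infinity HM) as [_ [[z [Hz _]] _]]. eauto. Qed.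

Lemma is_succ_exists y : exists z, is_succ z y.
Proof.
  destruct (gb_pairing HM y y) as [s Hs], (gb_pairing HM y s) as [d Hd],
    (gb_union HM d) as [z Hz].
  exists z. intros w. rewrite (Hz w). split.
  - intros [v [Hv Hw]]. apply Hd in Hv. destruct Hv; subst; auto.
    apply Hs in Hw. tauto.
  - intros [Hw|Hw].
    + exists y. split; [apply Hd; auto|exact Hw].
    + exists s. split; [apply Hd; auto|apply Hs; auto].
Qed.

Lemma is_numeral_exists n : exists z : gset M, is_numeral z n.
Proof.
  induction n as [|n [y Hy]]; simpl; [apply is_empty_exists|].
  destruct (is_succ_exists y) as [z Hz]. eauto.
Qed.

Lemma is_tuple_exists (l : list (gset M)) : exists t, is_tuple t l.
Proof.
  induction l as [|x l [t Ht]]; simpl; [apply is_empty_exists|].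
  destruct (is_opair_exists x t) as [z Hz]. eauto.
Qed.

Lemma is_numeral_functional n : forall x y, is_numeral x n -> is_numeral y n -> x = y.
Proof.
  induction n as [|n IH]; simpl; intros x y Hx Hy; apply (gb_ext HM); intros w.
  - split; intros Hw; [destruct (Hx w Hw)|destruct (Hy w Hw)].
  - destruct Hx as [x' [Hx' Sx]], Hy as [y' [Hy' Sy]].
    rewrite (Sx w), (Sy w), (IH x' y'); tauto.
Qed.

Lemma is_numeral_mem n : forall m x y,
  m < n -> is_numeral x m -> is_numeral y n -> mem x y.
Proof.
  induction n as [|n IH]; intros m x y Hmn Hx Hy; [lia|].
  destruct Hy as [y' [Hy' Sy]]. apply Sy.
  destruct (Nat.eq_dec m n) as [->|Hne].
  - right. exact (is_numeral_functional n _ _ Hx Hy').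
  - left. apply (IH m); auto. lia.
Qed.

Lemma mem_irrefl x : ~ mem x x.
Proof.
  intros Hx. destruct (gb_pairing HM x x) as [s Hs].
  destruct (gb_regularity HM s) as [y [Hy Hd]].
  - exists x. apply Hs. auto.
  - assert (y = x) as -> by (apply Hs in Hy; tauto). apply (Hd x). auto.
Qed.

(** Distinct standard numbers have distinct numerals: the smaller numeral is
    an element of the larger one, and no set is an element of itself. *)
Lemma is_numeral_inj z m n : is_numeral z m -> is_numeral z n -> m = n.
Proof.
  intros Hm Hn. destruct (lt_eq_lt_dec m n) as [[H|H]|H]; auto.
  - destruct (mem_irrefl z). exact (is_numeral_mem _ _ _ _ H Hm Hn).
  - destruct (mem_irrefl z). exact (is_numeral_mem _ _ _ _ H Hn Hm).
Qed.

Lemma is_tuple_map_inj {I : Type} (f g : I -> gset M) (l : list I) :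
  forall t, is_tuple t (map f l) -> is_tuple t (map g l) ->
  forall i, In i l -> f i = g i.
Proof.
  induction l as [|j l IH]; simpl; intros t Hf Hg i Hi; [tauto|].
  destruct Hf as [t1 [Hf E1]], Hg as [t2 [Hg E2]].
  destruct (is_opair_inj _ _ _ _ _ E1 E2) as [E ->].
  destruct Hi as [<-|Hi]; [exact E|]. exact (IH _ Hf Hg _ Hi).
Qed.

End Coding.

Lemma goedel_inj : forall phi psi, goedel phi = goedel psi -> phi = psi.
Proof.
  induction phi as [x y|x y|x X|X Y|f IHf g IHg|f IHf|x f IHf]; destruct psi;
    cbn [goedel]; intros H;
    apply Cantor.to_nat_inj in H; apply pair_equal_spec in H; destruct H as [H0 H];
    try discriminate H0;
    try (apply Cantor.to_nat_inj in H; apply pair_equal_spec in H; destruct H);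
    f_equal; auto.
Qed.

Lemma forces_star_ext {M : structure} (Sys : system M) F0 G phi :
  forall e e' p, (forall i, In i (free_vars phi) -> e i = e' i) ->
  forces_star Sys F0 e G phi p <-> forces_star Sys F0 e' G phi p.
Proof.
  induction phi as [x y|x y|x X|X Y|f IHf g IHg|f IHf|x f IHf];
    simpl; intros e e' p He.
  - rewrite !He by (apply (nodup_In Nat.eq_dec [x; y]); simpl; auto). tauto.
  - rewrite !He by (apply (nodup_In Nat.eq_dec [x; y]); simpl; auto). tauto.
  - rewrite He by auto. tauto.
  - tauto.
  - unfold fc_and. rewrite (IHf e e'), (IHg e e'); [tauto| |];
      intros i Hi; apply He, nodup_In, in_or_app; auto.
  - unfold fc_not. split; intros H q Hq Hle Hs; apply (H q Hq Hle);
      revert Hs; apply IHf; auto. intros i Hi. symmetry. auto.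
  - assert (H : forall z r, forces_star Sys F0 (upd e x z) G f r <->
                            forces_star Sys F0 (upd e' x z) G f r).
    { intros z r. apply IHf. intros i Hi. unfold upd.
      destruct (Nat.eq_dec i x); auto. apply He, in_in_remove; auto. }
    unfold fc_ex. split; intros K q Hq Hle;
      destruct (K q Hq Hle) as [r [Hr [Hrq [z [Hz Hs]]]]];
      exists r; split; auto; split; auto; exists z; split; auto; apply H, Hs.
Qed.

(** * The forcing relation *)

Lemma definable_in_list {M : structure} (HM : GB M) {I : Type}
    (P : I -> (nat -> gset M) -> Prop) (l : list I) :
  (forall i, definable (P i)) -> definable (fun e => exists i, In i l /\ P i e).
Proof.
  intros HP. induction l as [|j l IH].
  - apply definable_iff with (fun _ => False); [|exact (definable_False HM)].
    intros e. split; [tauto|]. intros [i [[] _]].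
  - apply definable_iff with (fun e => P j e \/ exists i, In i l /\ P i e).
    + intros e. split.
      * intros [H|[i [Hi H]]]; [exists j|exists i]; simpl; auto.
      * intros [i [[<-|Hi] H]]; eauto.
    + apply definable_or; auto.
Qed.

(** Truth of the scheme in every model of GB. *)
Theorem theorem14 (M : structure) (HM : GB M)
    (S : system M) (HSys : class_symmetric_system S)
    (F0 : gclass M) (HF0 : atomic_forcing_relation S F0)
    (phis : list form) (Gamma : nat -> gclass M)
    (HGamma : forall phi X, In phi phis -> In X (class_vars phi) ->
       class_S_name S (Gamma X)) :
  exists F : gclass M, forcing_relation S F0 phis Gamma F.
Proof.
  destruct (comprehension_projection HM
              (fun e => exists phi, In phi phis /\ forcing_code S F0 Gamma phi e))
    as [F HF].
  { apply definable_in_list; auto using definable_forcing_code. }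
  exists F. intros phi Hphi p _ e _. split.
  - intros [c [t [Hc [Ht [u [Hu [w [Hw HwF]]]]]]]].
    apply HF in HwF.
    destruct HwF as [e' [E0 [psi [_ [p' [c' [t' [u' [Hc' [Ht' [Hu' [Hw' Hs]]]]]]]]]]]].
    rewrite E0 in Hw'.
    destruct (is_opair_inj HM _ _ _ _ _ Hw Hw') as [-> ->].
    destruct (is_opair_inj HM _ _ _ _ _ Hu Hu') as [-> ->].
    pose proof (goedel_inj _ _ (is_numeral_inj HM _ _ _ Hc Hc')) as <-.
    revert Hs. apply forces_star_ext.
    exact (is_tuple_map_inj HM _ _ _ _ Ht Ht').
  - intros Hs.
    destruct (is_numeral_exists HM (goedel phi)) as [c Hc],
      (is_tuple_exists HM (map e (free_vars phi))) as [t Ht],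
      (is_opair_exists HM c t) as [u Hu], (is_opair_exists HM p u) as [w Hw].
    exists c, t. split; [exact Hc|]. split; [exact Ht|].
    exists u. split; [exact Hu|]. exists w. split; [exact Hw|]. apply HF.
    exists (fun n => match n with 0 => w | Datatypes.S i => e i end).
    split; [reflexivity|]. exists phi. split; [exact Hphi|]. exists p, c, t, u. auto.
Qed.
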